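(* Every simple C*-algebra of type $II_1$ is finite, i.e. every projection in it is finite.
   Context: For a C*-algebra $A$ and $S\subseteq A$, $\mathrm{Ann}(S)=\{a\in A: as+sa=0 \ \forall s\in S\}$; the lattice of annihilators of $A$ is $\mathcal{P}=\{\mathrm{Ann}(\mathrm{Ann}(S)): S\subseteq A_+\}$ ordered by inclusion. $A$ is of type $II_1$ if $\mathcal{P}$ is a modular lattice. A projection $p$ is infinite if it is Murray–von Neumann equivalent in $A$ to a proper subprojection of itself, and finite otherwise; a simple C*-algebra is finite if every projection in it is finite. *)

(* Defs.v *)
From mathcomp Require Import all_boot all_order all_algebra.
From mathcomp Require Import complex.
From mathcomp Require Import all_classical all_reals all_analysis.
Set Implicit Arguments. Unset Strict Implicit. Unset Printing Implicit Defensive.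
Import Num.Theory GRing.Theory.
Local Open Scope ring_scope.
Local Open Scope classical_set_scope.
Open Scope complex_scope.

Section CStar.
Context {R : realType} {A : completeNormedModType R[i]}.
Variables (mul : A -> A -> A) (st : A -> A).

Definition is_cstar_algebra : Prop :=
  (forall a b c, mul (mul a b) c = mul a (mul b c)) /\
  (forall a b c, mul (a + b) c = mul a c + mul b c) /\
  (forall a b c, mul a (b + c) = mul a b + mul a c) /\
  (forall (k : R[i]) a b, mul (k *: a) b = k *: mul a b) /\
  (forall (k : R[i]) a b, mul a (k *: b) = k *: mul a b) /\
  (forall a b, st (a + b) = st a + st b) /\
  (forall (k : R[i]) a, st (k *: a) = k^* *: st a) /\
  (forall a, st (st a) = a) /\
  (forall a b, st (mul a b) = mul (st b) (st a)) /\
  (forall a b, `|mul a b| <= `|a| * `|b|) /\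
  (forall a, `|mul (st a) a| = `|a| ^+ 2).

Definition positive_part : set A := [set x | exists b, x = mul (st b) b].

Definition Ann (S : set A) : set A :=
  [set a | forall s, S s -> mul a s + mul s a = 0].

Definition ann_lattice : set (set A) :=
  [set X | exists S, S `<=` positive_part /\ X = Ann (Ann S)].

End CStar.

Definition is_glb {T} (P : set (set T)) (x y m : set T) : Prop :=
  [/\ P m, m `<=` x, m `<=` y &
      forall w, P w -> w `<=` x -> w `<=` y -> w `<=` m].
Definition is_lub {T} (P : set (set T)) (x y j : set T) : Prop :=
  [/\ P j, x `<=` j, y `<=` j &
      forall w, P w -> x `<=` w -> y `<=` w -> j `<=` w].

Definition is_lattice {T} (P : set (set T)) : Prop :=
  forall x y, P x -> P y ->
    (exists m, is_glb P x y m) /\ (exists j, is_lub P x y j).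

Definition is_modular_lattice {T} (P : set (set T)) : Prop :=
  is_lattice P /\
  forall x y z, P x -> P y -> P z -> x `<=` z ->
    forall m j l r, is_glb P y z m -> is_lub P x y j ->
      is_lub P x m l -> is_glb P j z r -> l = r.

Section CStar2.
Context {R : realType} {A : completeNormedModType R[i]}.
Variables (mul : A -> A -> A) (st : A -> A).

Definition type_II1 : Prop := is_modular_lattice (ann_lattice mul st).

Definition closed_two_sided_ideal (I : set A) : Prop :=
  [/\ I 0, (forall a b, I a -> I b -> I (a + b)),
      (forall (k : R[i]) a, I a -> I (k *: a)),
      (forall a x, I a -> I (mul x a) /\ I (mul a x)) & closed I].

Definition simple_cstar : Prop :=
  forall I, closed_two_sided_ideal I -> I = [set 0] \/ I = setT.

Definition projection (p : A) : Prop := st p = p /\ mul p p = p.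

Definition mvn_equiv (p q : A) : Prop :=
  exists v, mul (st v) v = p /\ mul v (st v) = q.

Definition subprojection (q p : A) : Prop :=
  projection q /\ mul p q = q.

Definition infinite_projection (p : A) : Prop :=
  exists q, subprojection q p /\ q <> p /\ mvn_equiv p q.

Definition finite_projection (p : A) : Prop := ~ infinite_projection p.

Definition finite_cstar : Prop :=
  forall p, projection p -> finite_projection p.

End CStar2.

(* Main.v *)
(**
An infinite projection [p], with [v^* v = p] and [v v^* = q < p], yields the
"orthonormal" family [c_n = v^n (p - q)], with [c_i^* c_j = 0] for [i <> j] and
[c_i^* c_i = p - q]. Split it into [a_n] and [e_n]. As in an infinite-dimensional
Hilbert space, modularity fails for two closed subspaces whose sum is not
closed: let [x] be spanned by the [a_n], [z] by [x] and [e_0], and [y] by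
[g_n = 2 4^n a_n + 2 e_n - e_(n+1)]. Any [t] killing all [a_n] and [g_n]
satisfies [t e_(n+1) = 2 t e_n], and boundedness forces [t e_0 = 0]; hence
[z] lies below [x \/ y]. An element of [y /\ z] kills every [e_n] with [n > 0]
and the vectors [o_n] orthogonal to the [g_n], so that again
[t a_(n+1) = 2 t a_n] and [t] vanishes on the whole family; hence
[y /\ z = 0]. So [x < z] and [y] form a pentagon.
*)
Require Import Defs.
From mathcomp Require Import all_boot all_order all_algebra.
From mathcomp Require Import complex.
From mathcomp Require Import all_classical all_reals all_analysis.

Set Implicit Arguments. Unset Strict Implicit. Unset Printing Implicit Defensive.
Import Order.TTheory GRing.Theory Num.Theory.
Local Open Scope classical_set_scope.
Local Open Scope ring_scope.

Lemma mulrSn_eq0 (K : numFieldType) (V : lmodType K) (x : V) (n : nat) :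
  x *+ n.+1 = 0 -> x = 0.
Proof.
rewrite -scaler_nat => /eqP; rewrite scaler_eq0 pnatr_eq0 /=.
by move/eqP.
Qed.

Lemma bounded_doubling (R : realType) (V : normedModType R[i]) (x : nat -> V)
    (M : R[i]) :
  (forall n, x n.+1 = x n *+ 2) -> (forall n, `|x n| <= M) -> x 0%N = 0.
Proof.
move=> xS xM.
have xE n : x n = x 0%N *+ (2 ^ n).
  by elim: n => [|n IH]; rewrite ?expn0 ?mulr1n // xS IH -mulrnA expnSr.
have le_Re n : complex.Re `|x 0%N| *+ n <= complex.Re M.
  have : `|x 0%N| *+ n <= M.
    apply: le_trans (xM n); rewrite (xE n) normrMn.
    apply: ler_wpMn2l => //; exact/ltnW/ltn_expl.
  by rewrite lecE => /andP[_]; rewrite raddfMn.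
(* Norms lie in [R[i]], whose order makes every nonnegative element real, so the Archimedean
   argument can run on real parts. *)
have Re0 : 0 <= complex.Re `|x 0%N| /\ complex.Im `|x 0%N| = 0.
  by have := normr_ge0 (x 0%N); rewrite lecE => /andP[/eqP -> ->].
apply/normr0_eq0/eqP; rewrite eq_complex /= Re0.2 eqxx andbT.
rewrite eq_le Re0.1 andbT leNgt; apply/negP => Re_gt0.
have /archi_boundP : 0 <= complex.Re M / complex.Re `|x 0%N|.
  by apply: divr_ge0; [exact: le_Re 0%N|exact: ltW].
by rewrite ltNge ler_pdivlMr // mulr_natl le_Re.
Qed.

(** * Elementary calculus in a C*-algebra *)

Section Annihilators.
Context {R : realType} {A : completeNormedModType R[i]}.
Context {mul : A -> A -> A} {st : A -> A}.
Hypothesis cA : is_cstar_algebra mul st.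

Local Notation "a ** b" := (mul a b) (at level 40, left associativity).
Local Notation Ann := (Ann mul).

Lemma cmulA a b c : (a ** b) ** c = a ** (b ** c). Proof. by case: cA. Qed.
Lemma cmulDl a b c : (a + b) ** c = a ** c + b ** c.
Proof. by case: cA => _ []. Qed.
Lemma cmulDr a b c : a ** (b + c) = a ** b + a ** c.
Proof. by case: cA => _ [_ []]. Qed.
Lemma cstD a b : st (a + b) = st a + st b.
Proof. by case: cA => _ [_ [_ [_ [_ []]]]]. Qed.
Lemma cstK a : st (st a) = a.
Proof. by case: cA => _ [_ [_ [_ [_ [_ [_ []]]]]]]. Qed.
Lemma cstM a b : st (a ** b) = st b ** st a.
Proof. by case: cA => _ [_ [_ [_ [_ [_ [_ [_ []]]]]]]]. Qed.
Lemma cnormM a b : `|a ** b| <= `|a| * `|b|.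
Proof. by case: cA => _ [_ [_ [_ [_ [_ [_ [_ [_ []]]]]]]]]. Qed.
Lemma cnormst a : `|st a ** a| = `|a| ^+ 2.
Proof. by case: cA => _ [_ [_ [_ [_ [_ [_ [_ [_ []]]]]]]]]. Qed.

Lemma cmul0r a : 0 ** a = 0.
Proof. by apply: (addrI (0 ** a)); rewrite -cmulDl !addr0. Qed.
Lemma cmulr0 a : a ** 0 = 0.
Proof. by apply: (addrI (a ** 0)); rewrite -cmulDr !addr0. Qed.
Lemma cst0 : st 0 = 0.
Proof. by apply: (addrI (st 0)); rewrite -cstD !addr0. Qed.
Lemma cmulNl a b : (- a) ** b = - (a ** b).
Proof. by apply: (addrI (a ** b)); rewrite -cmulDl !subrr cmul0r. Qed.
Lemma cmulNr a b : a ** (- b) = - (a ** b).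
Proof. by apply: (addrI (a ** b)); rewrite -cmulDr !subrr cmulr0. Qed.
Lemma cstN a : st (- a) = - st a.
Proof. by apply: (addrI (st a)); rewrite -cstD !subrr cst0. Qed.
Lemma cmulMnl a b n : (a *+ n) ** b = (a ** b) *+ n.
Proof. by elim: n => [|n IH]; rewrite ?mulr0n ?cmul0r // !mulrS cmulDl IH. Qed.
Lemma cmulMnr a b n : a ** (b *+ n) = (a ** b) *+ n.
Proof. by elim: n => [|n IH]; rewrite ?mulr0n ?cmulr0 // !mulrS cmulDr IH. Qed.
Lemma cstMn a n : st (a *+ n) = st a *+ n.
Proof. by elim: n => [|n IH]; rewrite ?mulr0n ?cst0 // !mulrS cstD IH. Qed.

Lemma cst_mul_eq0 a : st a ** a = 0 -> a = 0.
Proof.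
move=> a0; apply/normr0_eq0/eqP; rewrite -sqrf_eq0 -cnormst a0.
by rewrite normr0.
Qed.

(** * Annihilators and modularity *)

Lemma Ann_sub (S T : set A) : S `<=` T -> Ann T `<=` Ann S.
Proof. by move=> ST a aT s /ST /aT. Qed.

Lemma sub_AnnAnn (S : set A) : S `<=` Ann (Ann S).
Proof. by move=> s Ss a /(_ s Ss); rewrite addrC. Qed.

(** Let [x], [y], [z] be the double annihilators of [Sx], [Sy], [Sz]. The meet of [y] and [z] is 0
    and [z] lies below the join of [x] and [y], so the modular law for [x] below [z] would collapse
    [z] onto [x]. *)
Lemma pentagon_not_type_II1 (Sx Sy Sz : set A) :
  Sx `<=` positive_part mul st -> Sy `<=` positive_part mul st ->
  Sz `<=` positive_part mul st -> Sx `<=` Sz ->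
  Ann (Sx `|` Sy) `<=` Ann Sz ->
  Ann (Ann Sy) `&` Ann (Ann Sz) `<=` [set 0] ->
  ~ (Ann (Ann Sz) `<=` Ann (Ann Sx)) -> ~ type_II1 mul st.
Proof.
move=> Sx0 Sy0 Sz0 Sxz joinE meetE nzx [latP modP]; apply: nzx.
set x := Ann (Ann Sx); set y := Ann (Ann Sy); set z := Ann (Ann Sz).
have Px : ann_lattice mul st x by exists Sx.
have Py : ann_lattice mul st y by exists Sy.
have Pz : ann_lattice mul st z by exists Sz.
have xz : x `<=` z by exact/Ann_sub/Ann_sub.
have [[m glbm] _] := latP _ _ Py Pz.
have [_ [j lubj]] := latP _ _ Px Py.
have [Pm my mz _] := glbm; have [Pj xj yj _] := lubj.
have [_ [l lubl]] := latP _ _ Px Pm.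
have [[r glbr] _] := latP _ _ Pj Pz.
have lr := modP _ _ _ Px Py Pz xz _ _ _ _ glbm lubj lubl glbr.
(* With [j = Ann (Ann S)], an element of [Ann S] kills all of [j], hence [Sx] and [Sy], hence [Sz]
   by [joinE]. *)
have zj : z `<=` j.
  have [S [_ jE]] := Pj; rewrite jE.
  apply: subset_trans (_ : Ann (Ann (Sx `|` Sy)) `<=` _); first exact: Ann_sub.
  apply: Ann_sub => a aS; have {}aS : Ann j a by rewrite jE; exact: sub_AnnAnn.
  move=> s [Ss|Ss]; apply: aS; first exact/xj/sub_AnnAnn.
  exact/yj/sub_AnnAnn.
have [_ _ _ rmax] := glbr; have [_ _ _ lmin] := lubl.
apply: subset_trans (rmax z Pz zj (@subset_refl _ z)) _.
rewrite -lr; apply: lmin => // a ma.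
have -> : a = 0 by apply: meetE; split; [exact: my|exact: mz].
by move=> s _; rewrite cmul0r cmulr0 addr0.
Qed.

(** The second clause is u^* a = 0 in adjoint form, so that arguments about left multiplication on
    [u] apply to [a] and to [st a] alike. *)
Definition annihilates (a u : A) : Prop := a ** u = 0 /\ st a ** u = 0.

(* [u u^*] is a positive multiple of a projection, so annihilating it in the
   Jordan sense means annihilating it on both sides. *)
Lemma annihilates_Jordan (a u : A) (k : nat) : u ** (st u ** u) = u *+ k.+1 ->
  a ** (u ** st u) + (u ** st u) ** a = 0 <-> annihilates a u.
Proof.
move=> uE; set s := u ** st u.
have su : s ** u = u *+ k.+1 by rewrite /s cmulA.
have ss : s ** s = s *+ k.+1 by rewrite {2}/s -cmulA su cmulMnl.
have sst : st s = s by rewrite /s cstM cstK.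
split=> [as0|[au sau]]; last first.
  have -> : a ** s = 0 by rewrite /s -cmulA au cmul0r.
  by rewrite -(cstK (s ** a)) cstM sst -cmulA sau cmul0r cst0 addr0.
(* Multiplying the Jordan relation by [s] on both sides gives 2(k+1) s a s = 0. Multiplying it by
   [s] on the left alone then gives (k+1) s a = 0. *)
have sas : s ** (a ** s) = 0.
  apply: (@mulrSn_eq0 _ _ _ (k + k.+1)%N); rewrite -addSn mulrnDr.
  have -> : (s ** (a ** s)) *+ k.+1 + (s ** (a ** s)) *+ k.+1 =
            s ** ((a ** s + s ** a) ** s).
    rewrite cmulDl cmulDr; congr (_ + _).
      by rewrite (cmulA a) ss !cmulMnr.
    by rewrite (cmulA s a) -(cmulA s s) ss cmulMnl.
  by rewrite as0 cmul0r cmulr0.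
have sa0 : s ** a = 0.
  apply: (@mulrSn_eq0 _ _ _ k); rewrite -cmulMnl -ss cmulA.
  by rewrite -[LHS]add0r -[X in X + _]sas -cmulDr as0 cmulr0.
have {sas}as0 : a ** s = 0 by rewrite -as0 sa0 addr0.
split; apply: (@mulrSn_eq0 _ _ _ k); rewrite -cmulMnr -su -cmulA.
  by rewrite as0 cmul0r.
by rewrite -sst -cstM sa0 cst0 cmul0r.
Qed.
(** Supplies members of [Ann S]. Testing a double annihilator against them shows that its elements
    annihilate every vector orthogonal to the generating ones. *)
Lemma orthogonal_annihilates (u w : A) :
  st u ** w = 0 -> annihilates (u ** st u) w.
Proof.
by move=> uw0; split; rewrite ?cstM ?cstK cmulA uw0 cmulr0.
Qed.

Lemma infinite_projection_orthonormal (p : A) :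
  projection mul st p -> infinite_projection mul st p ->
  exists r (c : nat -> A), [/\ r <> 0, forall n, c n ** r = c n &
    forall i j, st (c i) ** c j = r *+ (i == j)].
Proof.
move=> [stp pp] [q [[[stq qq] pq] [neq_qp [v [vv vvst]]]]].
(* The C*-identity applied to v p - v, using v^* v = p. *)
have vp : v ** p = v.
  apply/eqP; rewrite -subr_eq0; apply/eqP/cst_mul_eq0.
  rewrite cstD cstN cstM stp cmulDl !cmulDr !cmulNl !cmulNr.
  by rewrite !cmulA -(cmulA (st v) v p) vv !pp !subrr addr0.
have qv : q ** v = v by rewrite -vvst cmulA vv vp.
have pv : p ** v = v by rewrite -qv -cmulA pq.
have qp : q ** p = q by rewrite -stp -stq -cstM pq.
pose r := p - q.
have str : st r = r by rewrite cstD cstN stp stq.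
have rr : r ** r = r.
  by rewrite cmulDl !cmulDr !cmulNl !cmulNr pp pq qp qq opprK addrA subrK.
have rv : r ** v = 0 by rewrite cmulDl cmulNl pv qv subrr.
have pr : p ** r = r by rewrite cmulDr cmulNr pp pq.
pose c n := iter n (mul v) r.
have pc n : p ** c n = c n by case: n => [//|n]; rewrite /= -cmulA pv.
have c0S n : st (c 0%N) ** c n.+1 = 0 by rewrite /= str -cmulA rv cmul0r.
exists r, c; split.
- by move/eqP; rewrite subr_eq0 => /eqP pE; exact: neq_qp.
- by elim=> [|n IH]; rewrite /= ?rr // cmulA IH.
elim=> [|i IH] [|j].
- by rewrite /= str rr mulr1n.
- by rewrite c0S.
- by rewrite -[LHS]cstK cstM cstK c0S cst0.
(* Here v^* v = p cancels one [v] on each side and lowers both indices. *)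
- by rewrite /= cstM cmulA -(cmulA (st v)) vv pc IH.
Qed.

(** * The pentagon built from an orthonormal family *)

Section Orthonormal.
Variables (r : A) (c : nat -> A).
Hypothesis r_neq0 : r <> 0.
Hypothesis cr : forall n, c n ** r = c n.
Hypothesis stcc : forall i j, st (c i) ** c j = r *+ (i == j).

Let a n := c n.*2.
Let e n := c n.*2.+1.
(** The weights 2 4^n quadruple so that the vectors [o n], orthogonal to every [g m], have integer
    coefficients with [a m.+1] and [a m] in ratio -1 : 2. This ratio is the source of the doubling
    along the [a n]. *)
Let g n := a n *+ (2 * 4 ^ n) + e n *+ 2 - e n.+1.
Let o n :=
  if n is m.+1 then e n *+ 4 ^ n - a n + a m *+ 2 else e 0%N - a 0%N.

Let aa i j : st (a i) ** a j = r *+ (i == j).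
Proof. by rewrite stcc (inj_eq double_inj). Qed.
Let ee i j : st (e i) ** e j = r *+ (i == j).
Proof. by rewrite stcc eqSS (inj_eq double_inj). Qed.
Let ae i j : st (a i) ** e j = 0.
Proof.
rewrite stcc; case: eqP => // /(congr1 odd) /=.
by rewrite !odd_double.
Qed.
Let ea i j : st (e i) ** a j = 0.
Proof. by rewrite -[LHS]cstK cstM cstK ae cst0. Qed.
Let orthE := (cstD, cstN, cstMn, cmulDl, cmulDr, cmulNl, cmulNr, cmulMnl,
  cmulMnr, aa, ee, ae, ea).

Let scalar_gram u n :
  u ** r = u -> st u ** u = r *+ n.+1 -> u ** (st u ** u) = u *+ n.+1.
Proof. by move=> ur ->; rewrite cmulMnr ur. Qed.

Let ra n : a n ** r = a n. Proof. exact: cr. Qed.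
Let re n : e n ** r = e n. Proof. exact: cr. Qed.

Let gram_a n : a n ** (st (a n) ** a n) = a n *+ 1.
Proof. by apply: scalar_gram => //; rewrite aa eqxx. Qed.
Let gram_e n : e n ** (st (e n) ** e n) = e n *+ 1.
Proof. by apply: scalar_gram => //; rewrite ee eqxx. Qed.

Let simp0 := (mulr0n, mul0rn, oppr0, addr0, add0r, sub0r, subr0, @opprK A,
  mulr1n).

Let gram_g n : exists k, g n ** (st (g n) ** g n) = g n *+ k.+1.
Proof.
(* The squared length of [g n] is (2 4^n)^2 + 2^2 + 1, which is [k.+1]. *)
exists (2 * 4 ^ n * (2 * 4 ^ n) + 4)%N; apply: scalar_gram.
  by rewrite /g !orthE ra !re.
rewrite /g !orthE !eqxx (gtn_eqF (ltnSn n)) (ltn_eqF (ltnSn n)) !simp0.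
by rewrite -!mulrnA -mulrnDr -mulrSr -addnS.
Qed.

Let gram_o n : exists k, o n ** (st (o n) ** o n) = o n *+ k.+1.
Proof.
case: n => [|n].
  exists 1%N; apply: scalar_gram; first by rewrite /o !orthE ra re.
  by rewrite /o !orthE !eqxx !simp0.
exists (4 ^ n.+1 * 4 ^ n.+1 + 4)%N; apply: scalar_gram.
  by rewrite /o !orthE !ra !re.
rewrite /o !orthE !eqxx (gtn_eqF (ltnSn n)) (ltn_eqF (ltnSn n)) !simp0.
by rewrite -!mulrnA -mulrSr -mulrnDr addSn addnS.
Qed.

Let o_g m n : st (o m) ** g n = 0.
Proof.
case: m => [|m].
  rewrite /o /g !orthE; case: n => [|n] /=.
    by rewrite expn0 !simp0 subrr.
  by rewrite !simp0.
rewrite /o /g !orthE !eqSS !simp0.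
(* Overlaps occur in two cases: [n = m.+1] gives 2 4^n - 2 4^n, and [n = m] gives 2 2 4^m -
   4^(m+1). *)
have [<-|mn] := eqVneq m.+1 n.
  by rewrite (ltn_eqF (ltnSn m)) !simp0 mulNrn -mulrnA mulnC addNr.
have [<-|_] := eqVneq m n; last by rewrite !simp0.
by rewrite !simp0 -mulrnA mulnA expnS subrr.
Qed.

Let norm_c n : `|c n| = `|c 0%N|.
Proof. by apply/eqP; rewrite -(@eqrXn2 _ 2) // -!cnormst !stcc !eqxx. Qed.

Let bounded_c s n : `|s ** c n| <= `|s| * `|c 0%N|.
Proof. by rewrite -(norm_c n); exact: cnormM. Qed.

Let mul_e0_eq0 s :
  (forall n, s ** a n = 0) -> (forall n, s ** g n = 0) -> s ** e 0%N = 0.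
Proof.
move=> sa sg; apply: (@bounded_doubling _ _ (fun n => s ** e n)
  (`|s| * `|c 0%N|)).
  move=> n; apply/esym/eqP; rewrite -subr_eq0 -(sg n) /g.
  by rewrite !cmulDr cmulNr !cmulMnr sa mul0rn add0r.
by move=> n; exact: bounded_c.
Qed.

Let mul_a_eq0 s : (forall n, s ** e n.+1 = 0) -> (forall n, s ** o n = 0) ->
  forall n, s ** a n = 0.
Proof.
move=> se so.
have saS n : s ** a n.+1 = (s ** a n) *+ 2.
  apply/eqP; rewrite -subr_eq0 -oppr_eq0 -(so n.+1) /o.
  by rewrite !cmulDr cmulNr !cmulMnr se mul0rn add0r opprB addrC.
elim=> [|n IH]; last by rewrite saS IH mul0rn.
apply: (@bounded_doubling _ _ (fun n => s ** a n) (`|s| * `|c 0%N|)) => // n.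
exact: bounded_c.
Qed.

Let rk u := u ** st u.

Let rk_positive u : positive_part mul st (rk u).
Proof. by exists (st u); rewrite cstK. Qed.

Lemma orthonormal_not_type_II1 : ~ type_II1 mul st.
Proof.
pose Sx := range (rk \o a); pose Sy := range (rk \o g).
pose Sz := Sx `|` [set rk (e 0%N)].
have Ann_a s n : s ** rk (a n) + rk (a n) ** s = 0 <-> annihilates s (a n).
  exact: annihilates_Jordan (gram_a n).
have Ann_e s n : s ** rk (e n) + rk (e n) ** s = 0 <-> annihilates s (e n).
  exact: annihilates_Jordan (gram_e n).
have Ann_g s n : s ** rk (g n) + rk (g n) ** s = 0 <-> annihilates s (g n).
  by have [k] := gram_g n; exact: annihilates_Jordan.
have Ann_o s n : s ** rk (o n) + rk (o n) ** s = 0 <-> annihilates s (o n).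
  by have [k] := gram_o n; exact: annihilates_Jordan.
have Sz_pos : Sz `<=` positive_part mul st.
  by move=> _ [[n _ <-]|->]; exact: rk_positive.
have Ann_Sz s : (forall n, annihilates s (a n)) -> annihilates s (e 0%N) ->
    Ann Sz s.
  by move=> sa se _ [[n _ <-]|->]; [exact/Ann_a|exact/Ann_e].
apply: (@pentagon_not_type_II1 Sx Sy Sz) => //.
- by apply: subset_trans Sz_pos => s; left.
- by move=> _ [n _ <-]; exact: rk_positive.
- by move=> s; left.
- move=> s sS.
  have sa n : annihilates s (a n) by apply/Ann_a/sS; left; exists n.
  have sg n : annihilates s (g n) by apply/Ann_g/sS; right; exists n.
  apply: Ann_Sz => //; split; apply: mul_e0_eq0 => n; by case: (sa n); case: (sg n).
- move=> b [b_y b_z].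
  have be n : annihilates b (e n.+1).
    apply/Ann_e/b_z/Ann_Sz => [m|]; apply: orthogonal_annihilates; first exact: ea.
    by rewrite ee.
  have bo n : annihilates b (o n).
    apply/Ann_o/b_y => _ [m _ <-]; apply/Ann_g; apply: orthogonal_annihilates.
    exact: o_g.
  have ba n : annihilates b (a n).
    by split; apply: mul_a_eq0 => m; case: (be m); case: (bo m).
  (* Since o_0 = e_0 - a_0, vanishing passes from a_0 to e_0. *)
  have be0 : annihilates b (e 0%N).
    have [ba0 sba0] := ba 0%N; have [] := bo 0%N.
    by rewrite /o !cmulDr !cmulNr ba0 sba0 !subr0.
  have stb : Ann Sz (st b).
    by apply: Ann_Sz => [n|]; split; rewrite ?cstK; case: be0 => //; case: (ba n).
  have bb : b ** b = 0.
    by apply: (@mulrSn_eq0 _ _ _ 1); rewrite mulr2n; apply: b_z; exact: Ann_Sz.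
  apply: cst_mul_eq0; apply: cst_mul_eq0.
  have /eqP := b_z _ stb; rewrite addrC addr_eq0 => /eqP bE.
  rewrite cstM cstK {1}bE cmulNl cmulA -(cmulA (st b)) -cstM bb cst0 cmul0r.
  by rewrite cmulr0; exact: oppr0.
move=> zx.
(* If [z] were below [x], then [rk (e 0)], which lies in [z] and in [Ann Sx], would annihilate
   itself, forcing e_0 = 0 and r = 0. *)
have e0z : Ann (Ann Sz) (rk (e 0%N)) by apply: sub_AnnAnn; right.
have e0x : Ann Sx (rk (e 0%N)).
  by move=> _ [n _ <-]; apply/Ann_a; apply: orthogonal_annihilates; exact: ea.
have /Ann_e[ee0 _] := zx _ e0z _ e0x.
have e00 : e 0%N = 0 by rewrite -[LHS]mulr1n -gram_e -cmulA.
by apply: r_neq0; rewrite -[r]mulr1n -(ee 0%N 0%N) e00 cmulr0.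
Qed.
End Orthonormal.
End Annihilators.

Theorem theorem28 (R : realType) (A : completeNormedModType R[i])
  (mul : A -> A -> A) (st : A -> A) :
  is_cstar_algebra mul st ->
  simple_cstar mul ->
  type_II1 mul st ->
  finite_cstar mul st.
Proof.
move=> cA _ II1 p pp pinf.
have [r [c [r0 cr stcc]]] := infinite_projection_orthonormal cA pp pinf.
exact: orthonormal_not_type_II1 r0 cr stcc II1.
Qed.
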